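(* Let $V_{3}$ and $V_{4}$ be the varieties of bands defined (within the variety of bands) by the identities $yx\approx yxy$ and $xy\approx yxy$, respectively. Then $V_3$ and $V_4$ are mutually derived by $\sigma_{4}$, i.e. $(V_{3})_{\sigma_{4}}=V_{4}$ and $(V_{4})_{\sigma_{4}}=V_{3}$. Moreover, $\dim(V_{3})=\dim(V_{4})=1$.
   Context: A band is an idempotent semigroup, viewed as an algebra of type $(2)$ (one binary operation, written as juxtaposition). A hypersubstitution of type $(2)$ is a choice $\sigma$ of a binary term $\sigma(xy)$ in the variables $x,y$; $\sigma_4$ denotes the hypersubstitution with $\sigma_{4}(xy)=yx$. For an algebra $\mathbf{A}=(A,\cdot)$ of type $(2)$ the derived algebra $\mathbf{A}_{\sigma}$ is the set $A$ with the binary term operation induced by $\sigma(xy)$ on $\mathbf{A}$. For a variety $V$ of type $(2)$, the derived variety $V_{\sigma}$ is the variety (of type $(2)$) generated by $\{\mathbf{A}_{\sigma}:\mathbf{A}\in V\}$; it is proper if $V_{\sigma}\neq V$. The dimension $\dim(V)$ is the cardinality of the set of all proper derived varieties $V_{\sigma}$ of $V$ that are included in $V$, where $\sigma$ ranges over all hypersubstitutions of type $(2)$. *)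

(* Defs.v *)
From mathcomp Require Import all_boot.
From mathcomp Require Import all_classical.

Set Implicit Arguments.
Unset Strict Implicit.
Unset Printing Implicit Defensive.

Local Open Scope classical_set_scope.
Local Open Scope card_scope.

(* A (nonempty) algebra of type (2). A class of algebras is a [set algebra].
   MathComp's [magmaType] is not used because its universe lies above the one
   of [set], so that [set magmaType] is rejected. *)
Record algebra : Type := Algebra {
  carrier :> Type;
  carrier_inhabited : inhabited carrier;
  op : carrier -> carrier -> carrier
}.

Declare Scope algebra_scope.
Delimit Scope algebra_scope with alg.
Local Open Scope algebra_scope.
Notation "x * y" := (op x y) : algebra_scope.

Definition is_hom (A B : algebra) (f : A -> B) : Prop :=
  {morph f : x y / x * y}.

(* Binary terms in the variables x, y: these are the possible values of
   sigma(xy), so a hypersubstitution of type (2) is such a term. *)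
Inductive bterm : Type :=
  | Tx
  | Ty
  | Tmul of bterm & bterm.

Notation hypersubst := bterm.

Fixpoint beval (A : algebra) (t : bterm) (a b : A) : A :=
  match t with
  | Tx => a
  | Ty => b
  | Tmul t1 t2 => beval t1 a b * beval t2 a b
  end.

Definition sigma4 : hypersubst := Tmul Ty Tx.

Definition derived (s : hypersubst) (A : algebra) : algebra :=
  Algebra (carrier_inhabited A) (@beval A s).

Lemma product_inhabited (I : Type) (A : I -> algebra) :
  inhabited (forall i, A i).
Proof.
have h i : exists _ : A i, True by case: (carrier_inhabited (A i)) => a; exists a.
exact: inhabits (fun i => projT1 (cid (h i))).
Qed.

Definition product (I : Type) (A : I -> algebra) : algebra :=
  Algebra (product_inhabited A) (fun a b i => a i * b i).

(* Closure under subalgebras is stated for embedded algebras: by [variety_H],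
   a variety is in any case closed under isomorphism. The index type in
   [variety_P] may be empty, so every variety contains the trivial algebras. *)
Record is_variety (W : set algebra) : Prop := IsVariety {
  variety_H : forall (A B : algebra) (f : A -> B),
    W A -> is_hom f -> set_surj setT setT f -> W B;
  variety_S : forall (A B : algebra) (f : B -> A),
    W A -> is_hom f -> injective f -> W B;
  variety_P : forall (I : Type) (A : I -> algebra),
    (forall i, W (A i)) -> W (product A)
}.

Definition generated_variety (K : set algebra) : set algebra :=
  \bigcap_(W in [set W | is_variety W /\ K `<=` W]) W.

Definition derived_variety (V : set algebra) (s : hypersubst) : set algebra :=
  generated_variety (derived s @` V).

Definition proper_derived_subvarieties (V : set algebra) : set (set algebra) :=
  [set W | exists s : hypersubst,
     [/\ W = derived_variety V s, W <> V & W `<=` V]].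

(* [has_dim V n] reads dim(V) = n. *)
Definition has_dim (V : set algebra) (n : nat) : Prop :=
  proper_derived_subvarieties V #= `I_n.

Definition bands : set algebra :=
  [set A | associative (@op A) /\ forall x : A, x * x = x].

Definition V3 : set algebra :=
  [set A | bands A /\ forall x y : A, y * x = y * x * y].

Definition V4 : set algebra :=
  [set A | bands A /\ forall x y : A, x * y = y * x * y].

(* Main.v *)
Require Import Defs.
From mathcomp Require Import all_boot.
From mathcomp Require Import all_classical.

Set Implicit Arguments.
Unset Strict Implicit.
Unset Printing Implicit Defensive.

Local Open Scope classical_set_scope.
Local Open Scope algebra_scope.

(** Modulo the identities of V3, or of V4, every binary term equals x, y, xy or
    yx. These four terms derive from V3 the left zero bands, the right zero
    bands, V3 and V4 respectively, and only the left zero bands form a proper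
    subvariety of V3. For V4 the roles of left and right are exchanged. *)

(** * Classes defined by identities are varieties *)

Definition models (s t : bterm) : set algebra :=
  [set A : algebra | forall a b : A, beval s a b = beval t a b].

Definition left_zero : set algebra := models (Tmul Tx Ty) Tx.
Definition right_zero : set algebra := models (Tmul Tx Ty) Ty.

Lemma beval_hom (A B : algebra) (f : A -> B) (t : bterm) (a b : A) :
  is_hom f -> f (beval t a b) = beval t (f a) (f b).
Proof. by move=> fM; elim: t => //= t1 <- t2 <-; apply: fM. Qed.

Lemma beval_product (I : Type) (A : I -> algebra) (t : bterm)
    (a b : product A) (i : I) :
  beval t a b i = beval t (a i) (b i).
Proof. by elim: t => //= t1 -> t2 ->. Qed.

Lemma models_variety (s t : bterm) : is_variety (models s t).
Proof.
split=> [A B f st fM fS a b | A B f st fM fI a b | I A st a b].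
- have [x _ <-] := fS a I; have [y _ <-] := fS b I.
  by rewrite -!beval_hom // st.
- by apply: fI; rewrite !beval_hom // st.
- by apply: functional_extensionality_dep => i; rewrite !beval_product (st i).
Qed.

(** Associativity involves three variables, so it is not of the form [models s t] and the closure
    properties are checked directly. *)
Lemma associative_variety :
  is_variety [set A : algebra | associative (@op A)].
Proof.
split=> [A B f mA fM fS a b c | A B f mA fM fI a b c | I A mA a b c].
- have [x _ <-] := fS a I; have [y _ <-] := fS b I.
  by have [z _ <-] := fS c I; rewrite -!fM mA.
- by apply: fI; rewrite !fM mA.
- by apply: functional_extensionality_dep => i; apply: mA.
Qed.

Lemma varietyI (V W : set algebra) :
  is_variety V -> is_variety W -> is_variety (V `&` W).
Proof.
move=> [VH VS VP] [WH WS WP]; split.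
- by move=> A B f [VA WA] fM fS; split; [apply: VH fM fS | apply: WH fM fS].
- by move=> A B f [VA WA] fM fI; split; [apply: VS fM fI | apply: WS fM fI].
- by move=> I A VWA; split; [apply: VP | apply: WP] => i; case: (VWA i).
Qed.

Lemma bands_variety : is_variety bands.
Proof.
have -> : bands =
    [set A : algebra | associative (@op A)] `&` models (Tmul Tx Tx) Tx.
  apply/seteqP; split=> A [mA xx]; first by split=> // x y; apply: xx.
  by split=> // x; apply: (xx x x).
by apply: varietyI; [apply: associative_variety | apply: models_variety].
Qed.

Lemma V3_variety : is_variety V3.
Proof.
have -> : V3 = bands `&` models (Tmul Ty Tx) (Tmul (Tmul Ty Tx) Ty) by [].
by apply: varietyI; [apply: bands_variety | apply: models_variety].
Qed.

Lemma V4_variety : is_variety V4.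
Proof.
have -> : V4 = bands `&` models (Tmul Tx Ty) (Tmul (Tmul Ty Tx) Ty) by [].
by apply: varietyI; [apply: bands_variety | apply: models_variety].
Qed.

(** * Computing derived varieties *)

(** The hypotheses make [W] the exact image of [V] under [derived s]; as this image is already a
    variety, generation adds nothing. *)
Lemma derived_variety_eq (V W : set algebra) (s : hypersubst) :
  is_variety W -> (forall A, V A -> W (derived s A)) ->
  (forall B, W B -> exists2 A, V A & derived s A = B) ->
  derived_variety V s = W.
Proof.
move=> varW VW WV; apply/seteqP; split=> [A | B WB U [_ VU]].
  by apply; split=> // _ [B VB <-]; apply: VW.
by have [A VA <-] := WV B WB; apply: VU; exists A.
Qed.

(** Terms that agree throughout [V] induce equal operations, hence the same generators. This allows
    [s] to be replaced by a normal form. *)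
Lemma eq_derived_variety (V : set algebra) (s t : hypersubst) :
  V `<=` models s t -> derived_variety V s = derived_variety V t.
Proof.
move=> st; rewrite /derived_variety; congr generated_variety.
apply: eq_imagel => A VA; rewrite /derived; congr Algebra.
by apply/funext => a; apply/funext => b; apply: st.
Qed.

Lemma derived_op (A : algebra) : derived (Tmul Tx Ty) A = A.
Proof. by case: A. Qed.

Lemma derived_sigma4K : involutive (derived sigma4).
Proof. by case. Qed.

Lemma derived_left_zero (A : algebra) : left_zero A -> derived Tx A = A.
Proof.
case: A => T iT m zA; congr Algebra.
by apply/funext => a; apply/funext => b; rewrite -[LHS](zA a b).
Qed.

Lemma derived_right_zero (A : algebra) : right_zero A -> derived Ty A = A.
Proof.
case: A => T iT m zA; congr Algebra.
by apply/funext => a; apply/funext => b; rewrite -[LHS](zA a b).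
Qed.

Lemma derived_variety_op (V : set algebra) :
  is_variety V -> derived_variety V (Tmul Tx Ty) = V.
Proof.
move=> varV; apply: derived_variety_eq => // A VA; rewrite ?derived_op //.
by exists A; rewrite ?derived_op.
Qed.

(** The first projection is always a left zero operation, and left zero bands are fixed by
    [derived Tx]; the inclusion in [V] makes them all part of the image. *)
Lemma derived_variety_fst (V : set algebra) :
  left_zero `<=` V -> derived_variety V Tx = left_zero.
Proof.
move=> zV; apply: derived_variety_eq => [|//|B zB].
  exact: models_variety.
by exists B; [apply: zV | apply: derived_left_zero].
Qed.

Lemma derived_variety_snd (V : set algebra) :
  right_zero `<=` V -> derived_variety V Ty = right_zero.
Proof.
move=> zV; apply: derived_variety_eq => [|//|B zB].
  exact: models_variety.
by exists B; [apply: zV | apply: derived_right_zero].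
Qed.

(** The word yxy is a palindrome, so reversing products only moves its brackets, while yx becomes
    xy. *)
Lemma V4_sigma4_V3 (A : algebra) : V3 A -> V4 (derived sigma4 A).
Proof.
move=> [[mA xx] yxy]; split; first by split=> // x y z /=; rewrite mA.
by move=> x y /=; rewrite mA; apply: yxy.
Qed.

Lemma V3_sigma4_V4 (A : algebra) : V4 A -> V3 (derived sigma4 A).
Proof.
move=> [[mA xx] yxy]; split; first by split=> // x y z /=; rewrite mA.
by move=> x y /=; rewrite mA; apply: yxy.
Qed.

Lemma derived_V3_sigma4 : derived_variety V3 sigma4 = V4.
Proof.
apply: derived_variety_eq => [|A|B VB]; first exact: V4_variety.
  exact: V4_sigma4_V3.
by exists (derived sigma4 B); [apply: V3_sigma4_V4 | apply: derived_sigma4K].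
Qed.

Lemma derived_V4_sigma4 : derived_variety V4 sigma4 = V3.
Proof.
apply: derived_variety_eq => [|A|B VB]; first exact: V3_variety.
  exact: V3_sigma4_V4.
by exists (derived sigma4 B); [apply: V4_sigma4_V3 | apply: derived_sigma4K].
Qed.

(** * Zero bands and two-element witnesses *)

Lemma left_zero_V3 : left_zero `<=` V3.
Proof.
move=> A zA; have z (x y : A) : x * y = x by exact: zA.
by split=> [|x y]; first split=> [x y w|x]; rewrite !z.
Qed.

Lemma right_zero_V4 : right_zero `<=` V4.
Proof.
move=> A zA; have z (x y : A) : x * y = y by exact: zA.
by split=> [|x y]; first split=> [x y w|x]; rewrite !z.
Qed.

(** The zero bands on [bool] refute inclusions in [V4] and [V3]; the semilattice lies in both
    varieties but is not a zero band. All three share one carrier, so the projections derive the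
    first two from the third. *)
Definition left_zero2 : algebra := Algebra (inhabits true) (fun a _ : bool => a).
Definition right_zero2 : algebra := Algebra (inhabits true) (fun _ b : bool => b).
Definition semilattice2 : algebra := Algebra (inhabits true) andb.

Lemma left_zero2P : left_zero left_zero2. Proof. by []. Qed.
Lemma right_zero2P : right_zero right_zero2. Proof. by []. Qed.

Lemma right_zero2_notV3 : ~ V3 right_zero2.
Proof. by move=> [_ /(_ true false)]. Qed.

Lemma left_zero2_notV4 : ~ V4 left_zero2.
Proof. by move=> [_ /(_ true false)]. Qed.

Lemma semilattice2_V3 : V3 semilattice2.
Proof. by split; [split; [apply: andbA | case] | case; case]. Qed.

Lemma semilattice2_V4 : V4 semilattice2.
Proof. by split; [split; [apply: andbA | case] | case; case]. Qed.

Lemma left_zero_neqV3 : left_zero <> V3.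
Proof. by move=> e; have := semilattice2_V3; rewrite -e => /(_ true false). Qed.

Lemma right_zero_neqV4 : right_zero <> V4.
Proof. by move=> e; have := semilattice2_V4; rewrite -e => /(_ false true). Qed.

(** * Normal forms of binary terms *)

Variant normal_term : bterm -> Prop :=
  | NormalX : normal_term Tx
  | NormalY : normal_term Ty
  | NormalXY : normal_term (Tmul Tx Ty)
  | NormalYX : normal_term sigma4.

(** By induction on [s], it is enough that normal terms are closed under products modulo the
    identities of [V], which leaves sixteen cases. *)
Lemma exists_normal_term (V : set algebra) (s : bterm) :
  (forall s1 s2, normal_term s1 -> normal_term s2 ->
     exists2 t, normal_term t & V `<=` models (Tmul s1 s2) t) ->
  exists2 t, normal_term t & V `<=` models s t.
Proof.
move=> VM; elim: s => [||s1 [t1 n1 e1] s2 [t2 n2 e2]].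
- by exists Tx; first exact: NormalX.
- by exists Ty; first exact: NormalY.
have [t nt e] := VM t1 t2 n1 n2; exists t => // A VA a b.
by rewrite -(e A VA) /= (e1 A VA) (e2 A VA).
Qed.

(** Members of [V3] are the left regular bands: the rules nest products to the right and keep only
    the first occurrence of a letter. *)
Lemma V3_rewriting (A : algebra) : V3 A ->
  (forall x y z : A, x * y * z = x * (y * z)) *
  (forall x : A, x * x = x) *
  (forall x y : A, x * (x * y) = x * y) *
  (forall x y : A, x * (y * x) = x * y) *
  (forall x y z : A, x * (y * (x * z)) = x * (y * z)).
Proof.
move=> [[mA xx] yxy]; split=> [|x y z]; last by rewrite !mA -yxy.
split=> [|x y]; last by rewrite mA -yxy.
split=> [|x y]; last by rewrite mA xx.
by split=> // x y z; rewrite mA.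
Qed.

(** Dually, in right regular bands the last occurrence of a letter is kept. *)
Lemma V4_rewriting (A : algebra) : V4 A ->
  (forall x y z : A, x * y * z = x * (y * z)) *
  (forall x : A, x * x = x) *
  (forall x y : A, x * (x * y) = x * y) *
  (forall x y : A, x * (y * x) = y * x) *
  (forall x y z : A, x * (y * (x * z)) = y * (x * z)).
Proof.
move=> [[mA xx] yxy]; split=> [|x y z]; last by rewrite !mA -yxy.
split=> [|x y]; last by rewrite mA -yxy.
split=> [|x y]; last by rewrite mA xx.
by split=> // x y z; rewrite mA.
Qed.

(** The choice [+] backtracks: a candidate survives only if rewriting proves it equal to the given
    product. *)
Ltac solve_normal_term rewriting :=
  let A := fresh "A" in let VA := fresh "VA" in
  ((exists Tx; first exact: NormalX) +
   (exists Ty; first exact: NormalY) +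
   (exists (Tmul Tx Ty); first exact: NormalXY) +
   (exists sigma4; first exact: NormalYX));
  intros A VA ? ?; by rewrite /= ?(rewriting A VA).

Lemma V3_normal_term (s : bterm) :
  exists2 t, normal_term t & V3 `<=` models s t.
Proof.
apply: exists_normal_term => _ _ [] []; solve_normal_term V3_rewriting.
Qed.

Lemma V4_normal_term (s : bterm) :
  exists2 t, normal_term t & V4 `<=` models s t.
Proof.
apply: exists_normal_term => _ _ [] []; solve_normal_term V4_rewriting.
Qed.

(** * The unique proper derived subvariety *)

Lemma proper_derived_V3 : proper_derived_subvarieties V3 = [set left_zero].
Proof.
apply/seteqP; split=> [W [s [-> neqV subV]] | _ ->]; last first.
  exists Tx; rewrite derived_variety_fst; last exact: left_zero_V3.
  by split=> //; [apply: left_zero_neqV3 | apply: left_zero_V3].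
have [t nt st] := V3_normal_term s.
move: neqV subV; rewrite (eq_derived_variety st); case: nt => neqV subV /=.
- exact/derived_variety_fst/left_zero_V3.
(* Right zero bands need not lie in [V3], so [derived_variety_snd] does not apply. One bad member
   suffices: [derived Ty semilattice2] computes to [right_zero2]. *)
- case: right_zero2_notV3; apply: subV => U [_ KU]; apply: KU.
  by exists semilattice2; first exact: semilattice2_V3.
- by case: neqV; apply/derived_variety_op/V3_variety.
(* Here the derived variety is [V4], which contains [right_zero2]. *)
- case: right_zero2_notV3; apply: subV.
  by rewrite derived_V3_sigma4; apply/right_zero_V4/right_zero2P.
Qed.

Lemma proper_derived_V4 : proper_derived_subvarieties V4 = [set right_zero].
Proof.
apply/seteqP; split=> [W [s [-> neqV subV]] | _ ->]; last first.
  exists Ty; rewrite derived_variety_snd; last exact: right_zero_V4.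
  by split=> //; [apply: right_zero_neqV4 | apply: right_zero_V4].
have [t nt st] := V4_normal_term s.
move: neqV subV; rewrite (eq_derived_variety st); case: nt => neqV subV /=.
(* Now [Tx] is the excluded projection: [derived Tx semilattice2] computes to [left_zero2]. *)
- case: left_zero2_notV4; apply: subV => U [_ KU]; apply: KU.
  by exists semilattice2; first exact: semilattice2_V4.
- exact/derived_variety_snd/right_zero_V4.
- by case: neqV; apply/derived_variety_op/V4_variety.
- case: left_zero2_notV4; apply: subV.
  by rewrite derived_V4_sigma4; apply/left_zero_V3/left_zero2P.
Qed.

Theorem theorem4p5 :
  derived_variety V3 sigma4 = V4 /\
  derived_variety V4 sigma4 = V3 /\
  has_dim V3 1 /\
  has_dim V4 1.
Proof.
split; first exact: derived_V3_sigma4.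
split; first exact: derived_V4_sigma4.
by rewrite /has_dim proper_derived_V3 proper_derived_V4; split; apply: card_set1.
Qed.
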